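(* Let $G$ be a triangle-free graph with $\operatorname{diam}(G)=2$ and $\kappa(G)=3$. Then $G$ is reconstructible; that is, every graph $H$ with $\mathcal{D}(H)=\mathcal{D}(G)$ is isomorphic to $G$.
   Context: All graphs are finite and simple. $\operatorname{diam}(G)=\max_{u,v\in V(G)} d_G(u,v)$, where $d_G(u,v)$ is the length of a shortest path from $u$ to $v$ in $G$ (so a graph of finite diameter is connected). For a connected graph $G$, a set $S\subseteq V(G)$ is a cut set if $G-S$ is disconnected; the connectivity $\kappa(G)$ is the size of a smallest cut set. A card of $G$ is a graph $G-v$ with $v\in V(G)$, and the deck of $G$ is the multiset $\mathcal{D}(G)=\{G-v: v\in V(G)\}$, with cards considered up to isomorphism. Thus $\mathcal{D}(H)=\mathcal{D}(G)$ means there is a bijection $\varphi:V(G)\to V(H)$ with $G-v\cong H-\varphi(v)$ for all $v\in V(G)$. *)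

(* Defs.v *)
From mathcomp Require Import all_boot.

Set Implicit Arguments.
Unset Strict Implicit.
Unset Printing Implicit Defensive.

Record sgraph := SGraph {
  vertex :> finType;
  adj : rel vertex;
  adj_sym : symmetric adj;
  adj_irr : irreflexive adj
}.

Arguments adj {s} x y.

Lemma induced_sym (G : sgraph) (A : {set G}) :
  symmetric (fun x y : {x : G | x \in A} => adj (val x) (val y)).
Proof. by move=> x y; exact: adj_sym. Qed.

Lemma induced_irr (G : sgraph) (A : {set G}) :
  irreflexive (fun x y : {x : G | x \in A} => adj (val x) (val y)).
Proof. by move=> x; exact: adj_irr. Qed.

Definition induced (G : sgraph) (A : {set G}) : sgraph :=
  SGraph (@induced_sym G A) (@induced_irr G A).

Definition del_set (G : sgraph) (S : {set G}) : sgraph := induced (~: S).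

Definition card_at (G : sgraph) (v : G) : sgraph := del_set [set v].

Definition isomorphic (G H : sgraph) : Prop :=
  exists f : G -> H, bijective f /\ forall x y : G, adj (f x) (f y) = adj x y.

Definition triangle_free (G : sgraph) : Prop :=
  forall x y z : G, ~ [/\ adj x y, adj y z & adj x z].

Definition connected (G : sgraph) : Prop :=
  forall u v : G, connect (@adj G) u v.

Definition has_path (G : sgraph) (u v : G) (n : nat) : bool :=
  [exists p : n.-tuple G, [&& path adj u p, uniq (u :: p) & last u p == v]].

(* Paths have length less than #|G|, so the search below is exhaustive.  If u
   and v are in different components the value is the junk value #|G|, which is
   why [diameter] requires connectedness. *)
Definition dist (G : sgraph) (u v : G) : nat :=
  find (has_path u v) (iota 0 #|G|).

Definition diameter (G : sgraph) (d : nat) : Prop :=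
  connected G /\ \max_(u : G) \max_(v : G) dist u v = d.

Definition cut_set (G : sgraph) (S : {set G}) : Prop :=
  ~ connected (del_set S).

(* A relation rather than a function, since complete graphs have no cut set. *)
Definition connectivity (G : sgraph) (k : nat) : Prop :=
  [/\ connected G,
      exists2 S : {set G}, cut_set S & #|S| = k
    & forall S : {set G}, cut_set S -> k <= #|S|].

(* Equality of decks as multisets of isomorphism classes of cards. *)
Definition same_deck (G H : sgraph) : Prop :=
  exists phi : G -> H,
    bijective phi /\ forall v : G, isomorphic (card_at v) (card_at (phi v)).

Definition reconstructible (G : sgraph) : Prop :=
  forall H : sgraph, same_deck G H -> isomorphic H G.

(* Main.v *)
Require Import Defs.
From mathcomp Require Import all_boot.
From mathcomp Require Import zify.

Set Implicit Arguments.
Unset Strict Implicit.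
Unset Printing Implicit Defensive.

(** The graph [G] is rebuilt from a single well chosen card. Suppose that every
    neighbour of a vertex [w] either has degree 3, or is separated from another
    neighbour of [w] by more than distance 2 once [w] is deleted. Let [H] have
    the same deck. Then [H] arises from a copy of [G - w] by adding a vertex
    [w'], and it will be shown that [H] also has minimum degree at least 3 and
    diameter at most 2. Hence [w'] must be joined to every vertex that has
    degree 2 in [G - w] and to both members of every pair at distance more than
    2 there, that is, to all former neighbours of [w]; since [deg w' = deg w],
    there are no others, and [H] is [G] ([visible_isomorphic]).

    The deck determines degrees ([deck_deg]) by Kelly's counting. It determines
    the diameter through the numbers [N_k] of nonadjacent pairs with [k] common
    neighbours: summing over the cards of [G],
    [sum_v N_k(G - v) = (n - 2 - k) N_k(G) + (k + 1) N_(k+1)(G)], so all [N_k]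
    follow by descent from [N_(n-2)], which is 0 because degrees are smaller
    than [n - 2] ([deck_ncodeg], [deck_diam_le2]).

    It remains to find [w] ([exists_visible]). The minimum degree of [G] is at
    least 3, and in fact some [b] has degree 3: the traces of the vertices on a
    cut set of size 3 leave no room for edges on both sides ([cut3_deg3]). Let
    [nbr b = {s1, s2, s3}], and let [e_ij] tell whether some vertex is adjacent
    to [s_i] and [s_j] but not to the third. A neighbour [x] of [s1] adjacent
    to neither [s2] nor [s3] has only [s1] in common with [b]; one adjacent to
    all three has degree 3; and one adjacent to [s1] and [s2] only has nothing
    but [s1] in common with a vertex adjacent to [s1] and [s3] only. So [w = s1]
    works as soon as [e_12 = e_13] ([cubic_nbr_visible]). Among the three truth
    values [e_12], [e_13], [e_23] two are equal, and the indices of these two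
    pairs have an element in common, which gives [w]. *)

Definition nbr (G : sgraph) (x : G) : {set G} := [set y | adj x y].

Definition deg (G : sgraph) (x : G) : nat := #|nbr x|.

Definition apart (G : sgraph) (x y : G) : bool := ~~ ((x == y) || adj x y).

Definition diam_le2 (G : sgraph) : Prop :=
  forall x y : G, apart x y -> exists2 z, adj x z & adj y z.

Lemma adj_neq (G : sgraph) (x y : G) : adj x y -> x != y.
Proof. by move=> xy; apply/eqP => exy; move: xy; rewrite exy adj_irr. Qed.

(** * Cards *)

(** An isomorphism of cards, made into a map of the whole vertex sets that
    sends deleted vertex to deleted vertex; this avoids the subtypes. *)
Definition extends_card_iso (G H : sgraph) (v : G) (v' : H) (g : G -> H) : Prop :=
  [/\ bijective g, g v = v'
    & {in predC1 v &, forall x y, adj (g x) (g y) = adj x y}].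

Lemma card_iso_extend (G H : sgraph) (v : G) (v' : H) :
  #|G| = #|H| -> isomorphic (card_at v) (card_at v') ->
  exists g, extends_card_iso v v' g.
Proof.
move=> eqGH [f [bij_f adj_f]].
pose g (x : G) : H :=
  if insub x : option {x | x \in ~: [set v]} is Some u then val (f u) else v'.
have gv : g v = v' by rewrite /g insubN // !inE eqxx.
have gE x (xv : x != v) : exists2 u : card_at v, val u = x & g x = val (f u).
  have xA : x \in ~: [set v] by rewrite !inE.
  by exists (Sub x xA); rewrite ?SubK // /g insubT.
have gN x : x != v -> g x != v'.
  by case/gE => u _ ->; have := valP (f u); rewrite !inE.
exists g; split=> //; last first.
  move=> x y; rewrite !inE => /gE [u <- ->] /gE [t <- ->].
  exact: adj_f.
apply: inj_card_bij; last by rewrite eqGH.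
move=> x y; case: (eqVneq x v) => [-> | xv]; case: (eqVneq y v) => [-> | yv] //.
- by rewrite gv => e; have := gN _ yv; rewrite -e eqxx.
- by rewrite gv => e; have := gN _ xv; rewrite e eqxx.
have [u <- ->] := gE _ xv; have [t <- ->] := gE _ yv.
by move/val_inj/(bij_inj bij_f) ->.
Qed.

(** * Counting over the deck *)

Lemma card_edges_del (G : sgraph) (v : G) :
  #|[set p : G * G | [&& p.1 != v, p.2 != v & adj p.1 p.2]]| + (deg v).*2
  = #|[set p : G * G | adj p.1 p.2]|.
Proof.
rewrite -(cardsID [set p : G * G | (p.1 != v) && (p.2 != v)]
                  [set p : G * G | adj p.1 p.2]).
congr (_ + _).
  by apply: eq_card => -[x y]; rewrite !inE /= andbA andbC.
have -> : [set p : G * G | adj p.1 p.2] :\: [set p | (p.1 != v) && (p.2 != v)]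
   = [set (v, y) | y in nbr v] :|: [set (x, v) | x in nbr v].
  apply/setP => -[x y]; rewrite !inE /= negb_and !negbK.
  apply/andP/orP => [[/orP[]/eqP-> xy] | [] /imsetP [z]].
  - by left; apply: imset_f; rewrite inE.
  - by right; apply: imset_f; rewrite inE adj_sym.
  - by rewrite inE => vz [-> ->]; rewrite eqxx.
  - by rewrite inE => vz [-> ->]; rewrite eqxx orbT adj_sym.
rewrite cardsU.
have -> : [set (v, y) | y in nbr v] :&: [set (x, v) | x in nbr v] = set0.
  apply/setP => -[x y]; rewrite !inE; apply/negP.
  case/andP => /imsetP[z vz [-> ->]] /imsetP[t vt [e _]].
  by move: vt; rewrite !inE -e adj_irr.
rewrite cards0 subn0 !card_imset ?addnn // => x y; by case.
Qed.

(** Kelly's counting: a pair of distinct vertices survives in all but two of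
    the cards. *)
Lemma sum_card_del (G : sgraph) (P : pred (G * G)) :
  (forall p, P p -> p.1 != p.2) ->
  \sum_(v : G) #|[set p : G * G | [&& p.1 != v, p.2 != v & P p]]|
  = #|[set p | P p]| * (#|G| - 2).
Proof.
move=> Pneq.
under eq_bigr => v _ do rewrite -sum1dep_card.
rewrite (exchange_big_dep P) /=; last by move=> v p _ /and3P[].
rewrite -sum1dep_card big_distrl /=; apply: eq_bigr => p Pp.
rewrite sum1dep_card mul1n.
have -> : [set v | [&& p.1 != v, p.2 != v & P p]] = ~: [set p.1; p.2].
  by apply/setP => v; rewrite !inE Pp andbT negb_or !(eq_sym v).
by rewrite cardsCs setCK cards2 Pneq.
Qed.

Definition common (G : sgraph) (x y : G) : {set G} := nbr x :&: nbr y.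

(** These numbers capture the diameter: [ncodeg G 0] vanishes if and only if it
    is at most 2. The deck determines them all, but [ncodeg G 0] only through
    those with larger [k]. *)
Definition ncodeg (G : sgraph) (k : nat) : nat :=
  #|[set p : G * G | apart p.1 p.2 && (#|common p.1 p.2| == k)]|.

(** [ncodeg] of the card [G - v], computed inside [G]. *)
Definition ncodeg_del (G : sgraph) (v : G) (k : nat) : nat :=
  #|[set p : G * G | [&& p.1 != v, p.2 != v, apart p.1 p.2
                       & #|common p.1 p.2 :\ v| == k]]|.

(** A nonadjacent pair with [k] common neighbours in [G - v] has in [G] either
    [k] of them, and [v] is one of the [#|G| - 2 - k] vertices outside the pair
    and its common neighbourhood, or [k + 1] of them, and [v] is one of these. *)
Lemma sum_ncodeg_del (G : sgraph) (k : nat) :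
  \sum_(v : G) ncodeg_del v k
  = (#|G| - 2 - k) * ncodeg G k + k.+1 * ncodeg G k.+1.
Proof.
rewrite /ncodeg_del.
under eq_bigr => v _ do rewrite -sum1dep_card.
rewrite (exchange_big_dep (fun p : G * G => apart p.1 p.2)) /=; last first.
  by move=> v p _ /and4P[].
rewrite /ncodeg -!sum1dep_card !big_distrr /= !big_mkcondr -big_split /=.
apply: eq_bigr => -[x y] /= xy; rewrite sum1dep_card !muln1.
set C := common x y.
have [nxy _] := norP xy.
have inC v : (v \in C) = adj x v && adj y v by rewrite !inE.
have sC : C \subset ~: [set x; y].
  apply/subsetP => z; rewrite !inE => /andP[xz yz].
  by rewrite negb_or !(eq_sym z) !adj_neq.
have cardC2 : #|~: [set x; y]| = #|G| - 2 by rewrite cardsCs setCK cards2 nxy.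
case: (eqVneq #|C| k) => [Ck | nCk].
  rewrite [_ == k.+1]ltn_eqF ?Ck // addn0 -cardC2 -[in RHS]Ck.
  rewrite -(cardsDS sC); apply: eq_card => v.
  rewrite !inE xy /= negb_or !(eq_sym v).
  rewrite andbA [RHS]andbC; congr (_ && _).
  rewrite -inC; have := cardsD1 v C; rewrite Ck.
  by case: (v \in C) => /= ->; rewrite ?eqxx //; apply/eqP; lia.
case: (eqVneq #|C| k.+1) => [Ck | nCk1].
  rewrite add0n -[RHS]Ck; apply: eq_card => v; rewrite !inE xy /=.
  have := cardsD1 v C; rewrite Ck.
  have := subsetP sC v; rewrite !inE negb_or !(eq_sym v) andbA -inC.
  case: (v \in C) => /= [/(_ isT) -> e | _ e]; first by apply/eqP; case: e.
  by rewrite -[#|C :\ v|]add0n -e gtn_eqF ?andbF.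
rewrite addn0; apply/eqP; rewrite cards_eq0; apply/eqP/setP => v.
rewrite !inE xy /=; apply/negP => /and3P[_ _ /eqP Dk].
have := cardsD1 v C; rewrite Dk; case: (v \in C) => /=; lia.
Qed.

Lemma ncodeg0P (K : sgraph) : reflect (diam_le2 K) (ncodeg K 0 == 0).
Proof.
rewrite cards_eq0; apply: (iffP eqP) => [/setP N0 x y xy | D2].
  have := N0 (x, y); rewrite !inE /= xy /= => /negbT; rewrite -lt0n.
  by case/card_gt0P => z; rewrite !inE => /andP[xz yz]; exists z.
apply/setP => -[x y]; rewrite !inE /=; apply/negP => /andP[xy].
rewrite cards_eq0 => /eqP/setP C0; have [z xz yz] := D2 _ _ xy.
by have := C0 z; rewrite !inE xz yz.
Qed.

(** This starts the descent on [k] in [deck_ncodeg]. The hypothesis is about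
    degrees because these are known to agree in the two graphs. *)
Lemma ncodeg_top (K : sgraph) :
  (forall x : K, deg x < #|K| - 2) -> ncodeg K (#|K| - 2) = 0.
Proof.
move=> degK; apply/eqP; rewrite cards_eq0; apply/eqP/setP => -[x y].
rewrite !inE /=; apply/negP => /andP[_ /eqP C].
have := subset_leq_card (subsetIl (nbr x) (nbr y)).
by rewrite -/(common x y) C leqNgt degK.
Qed.

(** * What the deck determines *)

(** Every neighbour of [w] can be recognised in the card [G - w], given that
    [G] is to have diameter 2 and minimum degree 3: it has lost a necessary
    edge, or it has been separated from some [y] by more than distance 2. *)
Definition nbrs_visible (G : sgraph) (w : G) : Prop :=
  forall x, adj w x ->
    deg x = 3 \/
    exists y, [/\ apart x y, adj w y & forall z, adj x z -> adj y z -> z = w].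

Section Deck.

Variables (G H : sgraph) (phi : G -> H).
Hypothesis phi_bij : bijective phi.
Hypothesis phi_card : forall v : G, isomorphic (card_at v) (card_at (phi v)).

Let eqGH : #|G| = #|H| := bij_eq_card phi_bij.

Lemma deck_extends (v : G) : exists g, extends_card_iso v (phi v) g.
Proof. exact: card_iso_extend eqGH (phi_card v). Qed.

Lemma reindex_deck (F : H -> nat) : \sum_(w : H) F w = \sum_(v : G) F (phi v).
Proof. by rewrite (reindex phi) //; apply: onW_bij. Qed.

Lemma pair_card_bij (g : G -> H) (A : {set G * G}) (B : {set H * H}) :
  bijective g -> (forall x y, ((x, y) \in A) = ((g x, g y) \in B)) ->
  #|A| = #|B|.
Proof.
case=> h gK hK AB; pose gg (p : G * G) := (g p.1, g p.2).
have inj_gg : injective gg.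
  by move=> [x y] [z t] [/(can_inj gK)-> /(can_inj gK)->].
rewrite -(card_imset _ inj_gg); apply: eq_card => -[x y].
apply/imsetP/idP => [[[z t] zt ->] | xy]; first by rewrite -AB.
by exists (h x, h y); rewrite ?AB /gg /= !hK.
Qed.

Lemma deck_edges_del (v : G) :
  #|[set p : G * G | [&& p.1 != v, p.2 != v & adj p.1 p.2]]|
  = #|[set p : H * H | [&& p.1 != phi v, p.2 != phi v & adj p.1 p.2]]|.
Proof.
have [g [bij_g gv adj_g]] := deck_extends v.
apply: (pair_card_bij bij_g) => x y; rewrite !inE /= -gv !(bij_eq bij_g).
case: (eqVneq x v) => //= xv; case: (eqVneq y v) => //= yv.
by rewrite adj_g // inE.
Qed.

(** The cards give the number of edges, and [deg v] is half of what the card at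
    [v] lacks, as the edges are counted as ordered pairs. *)
Lemma deck_deg : 2 < #|G| -> forall v : G, deg (phi v) = deg v.
Proof.
move=> G_gt2 v.
have eqE : #|[set p : G * G | adj p.1 p.2]| = #|[set p : H * H | adj p.1 p.2]|.
  have pos : 0 < #|G| - 2 by rewrite subn_gt0.
  apply/eqP; rewrite -(eqn_pmul2r pos) {2}eqGH.
  rewrite -!(sum_card_del (P := fun p => adj p.1 p.2)).
  - by rewrite reindex_deck; apply/eqP; apply: eq_bigr => w _; apply: deck_edges_del.
  - by move=> p; apply: adj_neq.
  - by move=> p; apply: adj_neq.
have := card_edges_del (phi v); rewrite -eqE -(card_edges_del v) deck_edges_del.
by move/addnI/double_inj.
Qed.

Lemma deck_ncodeg_del (v : G) (k : nat) : ncodeg_del v k = ncodeg_del (phi v) k.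
Proof.
have [g [bij_g gv adj_g]] := deck_extends v; have [h gK hK] := bij_g.
apply: (pair_card_bij bij_g) => x y; rewrite !inE /= -gv !(bij_eq bij_g).
case: (eqVneq x v) => //= xv; case: (eqVneq y v) => //= yv.
rewrite /apart (bij_eq bij_g) adj_g ?inE //; congr (_ && _).
rewrite -(card_imset _ (bij_inj bij_g)); congr (#|pred_of_set _| == k).
apply/setP => z; rewrite -(hK z) (mem_imset _ _ (bij_inj bij_g)) !inE (bij_eq bij_g).
by case: (eqVneq (h z) v) => //= hz; rewrite !adj_g ?inE.
Qed.

(** The recurrence [sum_ncodeg_del] determines [ncodeg G k] from the deck and
    [ncodeg G k.+1]; it is run downwards from [#|G| - 2], where its leading
    coefficient vanishes and the deck gives no information. *)
Lemma deck_ncodeg :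
  ncodeg G (#|G| - 2) = ncodeg H (#|G| - 2) ->
  forall k, k <= #|G| - 2 -> ncodeg G k = ncodeg H k.
Proof.
move=> top k le_k; rewrite -(subKn le_k).
elim: (#|G| - 2 - k) (leq_subr k (#|G| - 2)) => [|j IHj] lt_j; first by rewrite subn0.
set i := #|G| - 2 - j.+1.
have i1 : i.+1 = #|G| - 2 - j by rewrite /i; lia.
have pos : 0 < #|G| - 2 - i by rewrite /i; lia.
apply/eqP; rewrite -(eqn_pmul2l pos) -(eqn_add2r (i.+1 * ncodeg G i.+1)).
rewrite -sum_ncodeg_del {2}i1 IHj 1?ltnW // -i1 {1}eqGH -sum_ncodeg_del.
by rewrite reindex_deck; apply/eqP/eq_bigr => v _; apply: deck_ncodeg_del.
Qed.

Lemma deck_diam_le2 :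
  2 < #|G| -> (forall x : G, deg x < #|G| - 2) -> diam_le2 G -> diam_le2 H.
Proof.
move=> G_gt2 degG /ncodeg0P/eqP N0; apply/ncodeg0P.
rewrite -deck_ncodeg ?N0 // !ncodeg_top // eqGH ncodeg_top // -?eqGH => x.
have [psi _ psiK] := phi_bij.
by rewrite -(psiK x) deck_deg.
Qed.

(** In [H] the image of a visible neighbour of [w] must be adjacent to the
    vertex that the card misses: otherwise it would keep degree 2, or stay at
    distance more than 2 from the image of its witness [y]. So the missing
    vertex is joined to at least the image of [nbr w], and since its degree is
    known, to nothing else. *)
Lemma visible_isomorphic (w : G) :
  2 < #|G| -> (forall x : G, 2 < deg x) -> diam_le2 H -> nbrs_visible w ->
  isomorphic H G.
Proof.
move=> G_gt2 deg_gt2 D2 vis.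
have [g [bij_g gw adj_g]] := deck_extends w; have [h gK hK] := bij_g.
have adj_gE x y : x != w -> y != w -> adj (g x) (g y) = adj x y.
  by move=> xw yw; rewrite adj_g ?inE.
have degH x : 2 < deg (g x).
  by have [psi _ psiK] := phi_bij; rewrite -(psiK (g x)) deck_deg.
have sub x : adj w x -> adj (g w) (g x).
  move=> wx; have xw : x != w by rewrite eq_sym adj_neq.
  case: (vis _ wx) => [dx | [y [xy wy uniq_w]]]; last first.
    have yw : y != w by rewrite eq_sym adj_neq.
    have gxy : apart (g x) (g y) by rewrite /apart (bij_eq bij_g) adj_gE.
    have [z xz yz] := D2 _ _ gxy.
    case: (eqVneq (h z) w) => [<- | hzw]; first by rewrite hK adj_sym.
    move: xz yz; rewrite -(hK z) (adj_gE x) // (adj_gE y) // => xz yz.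
    by case/eqP: hzw; apply: uniq_w xz yz.
  rewrite adj_sym; apply: contraTT (degH x) => gxw; rewrite -leqNgt -ltnS -dx.
  rewrite /deg (cardsD1 w (nbr x)) inE adj_sym wx ltnS.
  rewrite -(card_imset _ (bij_inj bij_g)); apply: subset_leq_card.
  apply/subsetP => z; rewrite inE => xz; rewrite -(hK z) imset_f // !inE.
  have hzw : h z != w by apply: contraNneq gxw => <-; rewrite hK.
  by rewrite hzw -adj_gE // hK.
have nbr_gw : g @: nbr w = nbr (g w).
  apply/eqP; rewrite eqEcard; apply/andP; split.
    by apply/subsetP => z /imsetP[x]; rewrite !inE => wx ->; apply: sub.
  by rewrite (card_imset _ (bij_inj bij_g)) gw -!/(deg _) deck_deg.
have adj_w x : adj (g w) (g x) = adj w x.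
  by have /setP/(_ (g x)) := nbr_gw; rewrite (mem_imset _ _ (bij_inj bij_g)) !inE.
have adj_all x y : adj (g x) (g y) = adj x y.
  case: (eqVneq x w) => [-> // | xw].
  case: (eqVneq y w) => [-> | yw]; first by rewrite adj_sym adj_w adj_sym.
  by rewrite adj_gE.
exists h; split; first by exists g.
by move=> x y; rewrite -{2}(hK x) -{2}(hK y) adj_all.
Qed.

End Deck.

(** * Triangle-free graphs of diameter two *)

Lemma diameter2_diam_le2 (G : sgraph) : 2 < #|G| -> diameter G 2 -> diam_le2 G.
Proof.
move=> G_gt2 [_ maxd] x y; rewrite /apart negb_or => /andP[nxy naxy].
have : dist x y <= 2.
  rewrite -maxd; apply: leq_trans (leq_bigmax x).
  exact: (leq_bigmax (F := fun v => dist x v) y).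
rewrite /dist => le2.
have lt_find : find (has_path x y) (iota 0 #|G|) < size (iota 0 #|G|).
  by rewrite size_iota; lia.
have := nth_find 0 (etrans (has_find _ _) lt_find).
rewrite nth_iota; last by rewrite size_iota in lt_find.
move: le2; case: (find _ _) => [|[|[|//]]] _ /existsP[p].
- by rewrite tuple0 /= (negbTE nxy).
- case/tupleP: p => z p; rewrite tuple0 /= => /and3P[/andP[xz _] _ /eqP zy].
  by rewrite -zy xz in naxy.
- case/tupleP: p => z p; case/tupleP: p => t p; rewrite tuple0 /=.
  move=> /and3P[/and3P[xz zt _] _ /eqP <-].
  by exists z => //; rewrite adj_sym.
Qed.

(** The component of [u] in [G - S] serves as [A]; all that is retained of it
    is that no edge of [G - S] leaves it. *)
Lemma cut_setP (G : sgraph) (S : {set G}) :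
  cut_set S -> exists A : {set G}, exists u v,
    [/\ u \in A, v \notin A, u \notin S, v \notin S
      & forall x y, x \in A -> y \notin A -> x \notin S -> y \notin S -> ~~ adj x y].
Proof.
move=> cutS.
have [u [v nuv]] : exists u v : del_set S, ~~ connect adj u v.
  case: (boolP [forall u : del_set S, forall v, connect adj u v]).
    by move/forallP => c; case: cutS => u v; have /forallP := c u; apply.
  by rewrite negb_forall => /existsP[u]; rewrite negb_forall => /existsP[v]; exists u, v.
pose A : {set G} := [set val w | w in [set w : del_set S | connect adj u w]].
have inA (w : del_set S) : (val w \in A) = connect adj u w.
  by rewrite (mem_imset _ _ val_inj) inE.
have nS (w : del_set S) : val w \notin S by have := valP w; rewrite inE.
exists A, (val u), (val v); split; rewrite ?inA //.
move=> x y Ax Ay Sx Sy; apply: contraNN Ay => xy.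
have xS : x \in ~: S by rewrite inE.
have yS : y \in ~: S by rewrite inE.
rewrite -[x]/(val (Sub x xS : del_set S)) inA in Ax.
rewrite -[y]/(val (Sub y yS : del_set S)) inA.
by apply: connect_trans Ax _; apply: connect1.
Qed.

(** The neighbourhood of a vertex of degree less than [k] would be a cut set:
    the existing cut set of size [k] ensures at least [k + 2] vertices, so that
    one of them is left on the other side. *)
Lemma connectivity_deg (G : sgraph) (k : nat) :
  connectivity G k -> forall x : G, k <= deg x.
Proof.
case=> conG [S cutS cardS] min_cut x; rewrite leqNgt; apply/negP => dx.
have [A [u [v [Au Av Su Sv _]]]] := cut_setP cutS.
have cardG : k.+2 <= #|G|.
  rewrite -cardS -(cardsC S) -addn2 leq_add2l.
  rewrite -(_ : #|[set u; v]| = 2); last by rewrite cards2 (memPn Av).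
  by apply: subset_leq_card; apply/subsetP => z; rewrite !inE => /orP[]/eqP->.
have [y] : exists y, y \in ~: (x |: nbr x).
  apply/card_gt0P; move: cardG; rewrite -(cardsC (x |: nbr x)).
  by rewrite cardsU1 !inE adj_irr -/(deg x) /=; lia.
rewrite !inE negb_or => /andP[yx nxy].
suff /min_cut : cut_set (nbr x) by rewrite -/(deg x) leqNgt dx.
have xN : x \in ~: nbr x by rewrite !inE adj_irr.
have yN : y \in ~: nbr x by rewrite !inE.
move/(_ (Sub x xN) (Sub y yN))/connectP => [[|z p] /=].
  by move=> _ /(congr1 val) /= e; rewrite e eqxx in yx.
case/andP => xz _ _; have := valP z; rewrite !inE; apply/negP; rewrite negbK.
exact: xz.
Qed.

Section TriangleFree.

Variable G : sgraph.
Hypothesis tfG : triangle_free G.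
Hypothesis D2 : diam_le2 G.

Lemma no_triangle (x y z : G) : adj x y -> adj x z -> ~~ adj y z.
Proof. by move=> xy xz; apply/negP => yz; apply: (tfG (x := x) (y := y) (z := z)). Qed.

Lemma disjoint_nbr (x y : G) : adj x y -> nbr x :&: nbr y = set0.
Proof.
move=> xy; apply/setP => z; rewrite !inE; apply/negP => /andP[xz].
by apply/negP; apply: no_triangle xz.
Qed.

(** A vertex and any of its neighbours have disjoint neighbourhoods. *)
Lemma deg_lt (x : G) : (forall y : G, 2 < deg y) -> deg x < #|G| - 2.
Proof.
move=> deg_gt2; have /card_gt0P[y] : 0 < #|nbr x| by apply: leq_trans (deg_gt2 x).
rewrite inE => xy; have := cardsUI (nbr x) (nbr y).
rewrite (disjoint_nbr xy) cards0 addn0 => e.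
by have := max_card (nbr x :|: nbr y); rewrite e; have := deg_gt2 y; rewrite /deg; lia.
Qed.

(** Vertices on different sides of the cut have a common neighbour in [S], so
    their traces on [S] meet; the traces of adjacent vertices are disjoint. If
    neither [u] nor [v] had its neighbourhood inside [S], there would be edges
    [u u'] and [v v'] on the two sides. The trace of [v] meets the disjoint
    traces of [u] and [u'], so it has two elements, and so does that of [v'];
    but two disjoint pairs do not fit in [S]. *)
Lemma cut3_deg3 (S : {set G}) : cut_set S -> #|S| = 3 -> exists b : G, deg b <= 3.
Proof.
move=> cutS cardS; have [A [u [v [Au Av Su Sv sep]]]] := cut_setP cutS.
have cross x y : x \in A -> y \notin A -> x \notin S -> y \notin S ->
    exists2 s, s \in nbr x :&: S & s \in nbr y :&: S.
  move=> Ax Ay Sx Sy.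
  have xy : apart x y.
    by rewrite /apart negb_or sep // andbT; apply: contraNneq Ay => <-.
  have [z xz yz] := D2 xy.
  have Sz : z \in S.
    apply: contraT => Sz; case: (boolP (z \in A)) => Az.
      by have := sep _ _ Az Ay Sz Sy; rewrite adj_sym yz.
    by have := sep _ _ Ax Az Sx Sz; rewrite xz.
  by exists z; rewrite !inE ?xz ?yz.
case: (boolP (nbr u \subset S)) => [sub | /subsetPn[u']].
  by exists u; rewrite -cardS; apply: subset_leq_card.
rewrite inE => uu' Su'.
case: (boolP (nbr v \subset S)) => [sub | /subsetPn[v']].
  by exists v; rewrite -cardS; apply: subset_leq_card.
rewrite inE => vv' Sv'.
have Au' : u' \in A by apply: contraLR uu' => Au'; apply: sep.
have Av' : v' \notin A by apply: contraL vv' => Av'; rewrite adj_sym sep.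
have trace_gt1 y : y \notin A -> y \notin S -> 1 < #|nbr y :&: S|.
  move=> Ay Sy; have [s us ys] := cross u y Au Ay Su Sy.
  have [s' us' ys'] := cross u' y Au' Ay Su' Sy.
  have ss' : s != s'.
    apply/eqP => e; have /setP/(_ s) := disjoint_nbr uu'.
    by move: us us'; rewrite -e !inE => /andP[-> _] /andP[-> _].
  apply: leq_trans (subset_leq_card (_ : [set s; s'] \subset _)).
    by rewrite cards2 ss'.
  by apply/subsetP => z; rewrite inE => /orP[]/set1P->.
have := cardsUI (nbr v :&: S) (nbr v' :&: S).
have -> : nbr v :&: S :&: (nbr v' :&: S) = set0.
  by rewrite setIACA (disjoint_nbr vv') set0I.
have le3 : #|nbr v :&: S :|: nbr v' :&: S| <= 3.
  by rewrite -cardS; apply: subset_leq_card; rewrite subUset !subsetIr.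
have := trace_gt1 v Av Sv; have := trace_gt1 v' Av' Sv'.
by rewrite cards0; lia.
Qed.

Definition has_trace2 (s t r : G) : bool :=
  [exists x, [&& adj x s, adj x t & ~~ adj x r]].

Lemma has_trace2C (s t r : G) : has_trace2 s t r = has_trace2 t s r.
Proof. by apply: eq_existsb => x; rewrite andbCA. Qed.

(** Every vertex other than [b] and its neighbours has a nonempty trace on
    [nbr b = {s, t, r}]. Let [x] be a neighbour of [s]. If its trace is
    everything, then [x] has no neighbour outside [nbr b], as the traces of
    adjacent vertices are disjoint; so its degree is 3. If its trace is [{s}],
    then [b] is a witness. If its trace is [{s, t}], then any [y] of trace
    [{s, r}] is a witness, since a common neighbour outside [nbr b] would have
    a trace disjoint from both; the hypothesis on [has_trace2] provides [y]. *)
Lemma cubic_nbr_visible (b s t r : G) :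
  (forall x : G, 2 < deg x) -> deg b = 3 -> nbr b = [set s; t; r] ->
  has_trace2 s t r = has_trace2 s r t -> nbrs_visible s.
Proof.
move=> deg_gt2 deg_b nbr_b eq_tr x sx.
have inb z : adj b z = [|| z == s, z == t | z == r].
  by have /setP/(_ z) := nbr_b; rewrite !inE -orbA.
have bs : adj b s by rewrite inb eqxx.
case: (eqVneq x b) => [-> | xb]; first by left.
have nbx : ~~ adj b x by rewrite adj_sym; apply: no_triangle sx _; rewrite adj_sym.
have trace z : z != b -> ~~ adj b z -> [|| adj z s, adj z t | adj z r].
  move=> zb bz; have [|q] := D2 (x := z) (y := b).
    by rewrite /apart negb_or zb adj_sym.
  by move=> zq; rewrite inb => /or3P[]/eqP<-; rewrite zq ?orbT.
have xs : adj x s by rewrite adj_sym.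
(* The case of trace {s, p} is used with p = t and with p = r. *)
have use_other p q : (forall z, adj b z = [|| z == s, z == p | z == q]) ->
    (forall z, z != b -> ~~ adj b z -> [|| adj z s, adj z p | adj z q]) ->
    adj x p -> ~~ adj x q -> has_trace2 s q p ->
    exists y, [/\ apart x y, adj s y & forall z, adj x z -> adj y z -> z = s].
  move=> inb' trace' xp xq /existsP[y /and3P[ys yq yp]]; exists y; split.
  - rewrite /apart negb_or; apply/andP; split; last by apply: (no_triangle sx); rewrite adj_sym.
    by apply: contraNneq yp => <-.
  - by rewrite adj_sym.
  move=> z xz yz; case: (boolP (adj b z)) => [|bz].
    rewrite inb' => /or3P[]/eqP // ez.
      by move: yz; rewrite ez (negbTE yp).
    by move: xz; rewrite ez (negbTE xq).
  have zb : z != b by apply: contraNneq nbx => <-; rewrite adj_sym.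
  case/or3P: (trace' _ zb bz) => zc.
  - by have := no_triangle xz xs; rewrite zc.
  - by have := no_triangle xz xp; rewrite zc.
  - by have := no_triangle yz yq; rewrite zc.
case: (boolP (adj x t)) => xt; case: (boolP (adj x r)) => xr.
- left; apply/eqP; rewrite eqn_leq deg_gt2 andbT -deg_b.
  apply: subset_leq_card; apply/subsetP => z; rewrite !inE => xz.
  apply: contraT => bz.
  have zb : z != b by apply: contraNneq nbx => <-; rewrite adj_sym.
  case/or3P: (trace _ zb bz) => zc.
  - by have := no_triangle xz xs; rewrite zc.
  - by have := no_triangle xz xt; rewrite zc.
  - by have := no_triangle xz xr; rewrite zc.
- right; apply: (use_other t r) => //; rewrite -eq_tr.
  by apply/existsP; exists x; rewrite xs xt.
- right; apply: (use_other r t) => //.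
  + by move=> z; rewrite inb [(z == t) || _]orbC.
  + by move=> z zb bz; have := trace _ zb bz; rewrite [adj z t || _]orbC.
  + by rewrite eq_tr; apply/existsP; exists x; rewrite xs xr.
- right; exists b; split.
  + by rewrite /apart negb_or xb adj_sym.
  + by rewrite adj_sym.
  + move=> z xz; rewrite inb => /or3P[]/eqP // ez; move: xz; rewrite ez.
      by rewrite (negbTE xt).
    by rewrite (negbTE xr).
Qed.

(** Three truth values, one for each pair of neighbours of [b]: two of them
    agree, and the two pairs concerned share a neighbour. *)
Lemma exists_visible (b : G) :
  (forall x : G, 2 < deg x) -> deg b = 3 -> exists w : G, nbrs_visible w.
Proof.
move=> deg_gt2 deg_b.
have [s [t [r nbr_b]]] : exists s t r, nbr b = [set s; t; r].
  have /card_gt0P[s bs] : 0 < #|nbr b| by rewrite -/(deg b) deg_b.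
  have /cards2P[t [r [_ e]]] : #|nbr b :\ s| == 2.
    by move: deg_b; rewrite /deg (cardsD1 s) bs => /(@addnI 1 _ 2) ->.
  by exists s, t, r; rewrite -setUA -e setD1K.
have vis := cubic_nbr_visible deg_gt2 deg_b.
case: (eqVneq (has_trace2 s t r) (has_trace2 s r t)) => [e1 | n1].
  by exists s; apply: vis nbr_b e1.
case: (eqVneq (has_trace2 t s r) (has_trace2 t r s)) => [e2 | n2].
  by exists t; apply: (vis t s r) e2; rewrite nbr_b [[set t] :|: _]setUC.
exists r; apply: (vis r s t).
  by rewrite nbr_b setUC setUA.
move: n1 n2; rewrite (has_trace2C t s) (has_trace2C r s) (has_trace2C r t).
by do 3 case: (has_trace2 _ _ _).
Qed.

End TriangleFree.

Theorem theorem1p4 (G : sgraph) (tfG : triangle_free G)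
  (diamG : diameter G 2) (kappaG : connectivity G 3) :
  reconstructible G.
Proof.
move=> H [phi [phi_bij phi_card]].
have deg_gt2 : forall x : G, 2 < deg x := connectivity_deg kappaG.
have [_ [S cutS cardS] _] := kappaG.
have G_gt2 : 2 < #|G| by rewrite -cardS max_card.
have D2 := diameter2_diam_le2 G_gt2 diamG.
have [b deg_b] := cut3_deg3 tfG D2 cutS cardS.
have [w vis] : exists w : G, nbrs_visible w.
  by apply: (exists_visible tfG D2 (b := b)) => //; apply/eqP; rewrite eqn_leq deg_b deg_gt2.
have D2H : diam_le2 H.
  by apply: (deck_diam_le2 phi_bij phi_card) => // x; apply: deg_lt.
exact: (visible_isomorphic phi_bij phi_card G_gt2 deg_gt2 D2H vis).
Qed.
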